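(* Let $K$ be a finite field with $q$ elements, let $w_1,w_2$ be positive integers with $\gcd(w_1,w_2)=1$, and let $\chi$ be the characteristic function of $Q=\langle w_1,w_2\rangle\subset\mathbb{N}$. Let $0\leq d\leq w_1w_2(q-1)-w_1-w_2$ with $d\in Q$. Write $d=kw_1w_2+l$ with integers $k\geq 0$ and $0\leq l<w_1w_2$. Then the minimum distance of the weighted projective Reed--Muller code $C_{\mathbb{T}}(d)$ of order $d$ over $\mathbb{T}(w_1,w_2)$ is $(q-1)-k+1-\chi(l)$.
   Context: $\mathbb{N}=\{0,1,2,\dots\}$. The weighted projective space $\mathbb{P}(w_1,w_2)$ is the quotient $(K^2\setminus 0)/K^*$, where $\lambda\in K^*$ acts by $\lambda(x_1,x_2)=(\lambda^{w_1}x_1,\lambda^{w_2}x_2)$. The weighted projective torus is $\mathbb{T}(w_1,w_2)=\{(x_1,x_2)\in\mathbb{P}(w_1,w_2): x_1x_2\neq 0\}$. The polynomial ring $K[t_1,t_2]$ is graded by $\deg(t_1)=w_1$, $\deg(t_2)=w_2$. Let $m=|\mathbb{T}(w_1,w_2)|$ and fix systems of homogeneous coordinates $\underline{x}_1,\dots,\underline{x}_m\in K^2$ of the points of $\mathbb{T}(w_1,w_2)$. For $d\geq 0$ let $\operatorname{ev}_d\colon K[t_1,t_2]_d\to K^m$ be $f\mapsto(f(\underline{x}_1),\dots,f(\underline{x}_m))$. The image of $\operatorname{ev}_d$ is $C_{\mathbb{T}}(d)$, the weighted projective Reed--Muller code over $\mathbb{T}(w_1,w_2)$ of order $d$ (its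 minimum distance does not depend on the choice of coordinates). The minimum distance of a nonzero linear code $C\subset K^m$ is $\min\{\|\underline{x}\|:\underline{x}\in C\setminus 0\}$, where $\|\underline{x}\|$ is the Hamming weight, i.e. the number of nonzero components of $\underline{x}$. $Q=\langle w_1,w_2\rangle$ is the submonoid of $\mathbb{N}$ generated by $w_1,w_2$, and $\chi\colon\mathbb{N}\to\{0,1\}$ is given by $\chi(n)=1$ if $n\in Q$ and $\chi(n)=0$ otherwise. *)

(* Defs.v *)
From HB Require Import structures.
From mathcomp Require Import all_boot all_order all_algebra all_fingroup.
From mathcomp Require Import finalg.
From mathcomp Require Import mpoly.

(* Plain Mathematical Components; K[t1, t2] is {mpoly K[2]}, with t1 the variable
   of index ord0 and t2 that of index ord_max. *)

Set Implicit Arguments.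
Unset Strict Implicit.
Unset Printing Implicit Defensive.

Import GRing.Theory.
Local Open Scope ring_scope.

Section WeightedDegree.
Variables w1 w2 : nat.

Definition wdeg (m : 'X_{1..2}) : nat := (w1 * m ord0 + w2 * m ord_max)%N.

Lemma wdeg0 : wdeg 0%MM = 0%N.
Proof. by rewrite /wdeg !mnm0E !muln0. Qed.

Lemma wdegD : {morph wdeg : m1 m2 / (m1 + m2)%MM >-> (m1 + m2)%N}.
Proof. by move=> m1 m2; rewrite /wdeg !mnmDE !mulnDr addnACA. Qed.

HB.instance Definition _ := isMeasure.Build 2 wdeg wdeg0 wdegD.

End WeightedDegree.

Section WeightedProjectiveLine.
Variables (K : finFieldType) (w1 w2 : nat).

Definition wscale (x : K * K) (lam : {unit K}) : K * K :=
  (val lam ^+ w1 * x.1, val lam ^+ w2 * x.2).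

Lemma wscale1 : wscale^~ 1%g =1 id.
Proof. by case=> x1 x2; rewrite /wscale /= !expr1n !mul1r. Qed.

Lemma wscaleM x : act_morph wscale x.
Proof.
by move=> a b; rewrite /wscale /= !exprMn !mulrA ![val b ^+ _ * _]mulrC.
Qed.

Canonical wscale_action : {action {unit K} &-> K * K} :=
  TotalAction wscale1 wscaleM.

(* The point of the weighted projective space with homogeneous coordinates x
   is the set of all its homogeneous coordinates. *)
Definition wpoint (x : K * K) : {set K * K} :=
  orbit wscale_action [set: {unit K}] x.

Definition wpspace : {set {set K * K}} := wpoint @: [set~ (0, 0)].

Definition wptorus : {set {set K * K}} :=
  [set P in wpspace | [forall x in P, x.1 * x.2 != 0]].

(* Nonvanishing of x1 * x2 does not depend on the choice of coordinates. *)
Lemma wpoint_torus (x : K * K) : (wpoint x \in wptorus) = (x.1 * x.2 != 0).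
Proof.
rewrite inE; apply/andP/idP => [[_ /forall_inP nz]|nzx].
  by apply: nz; exact: orbit_refl.
split.
  apply: imset_f; rewrite !inE; apply: contraNneq nzx => ->.
  by rewrite mul0r.
apply/forall_inP => y /orbitP[a _ <-] /=.
have nza: val a != 0 by rewrite -unitfE (valP a).
move: nzx; rewrite !mulf_eq0 !negb_or => /andP[x1 x2].
by rewrite x1 x2 !expf_neq0.
Qed.

Definition torus_coords (x : 'I_#|wptorus| -> K * K) : Prop :=
  injective (wpoint \o x) /\ [set wpoint (x i) | i in 'I_#|wptorus|] = wptorus.

Definition evalpt (f : {mpoly K[2]}) (x : K * K) : K :=
  f.@[tnth [tuple x.1; x.2]].

Definition ev m (x : 'I_m -> K * K) (f : {mpoly K[2]}) : 'rV[K]_m :=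
  \row_i evalpt f (x i).

Definition wprm_code m (x : 'I_m -> K * K) (d : nat) (c : 'rV[K]_m) : Prop :=
  exists2 f : {mpoly K[2]}, f \is d.-homog for (wdeg w1 w2) & c = ev x f.

Lemma wprm_code0 m (x : 'I_m -> K * K) d : wprm_code x d 0.
Proof.
exists 0; first exact: dhomog0.
by apply/rowP => i; rewrite !mxE /evalpt meval0.
Qed.

Lemma wprm_codeP m (x : 'I_m -> K * K) d a c1 c2 :
  wprm_code x d c1 -> wprm_code x d c2 -> wprm_code x d (a *: c1 + c2).
Proof.
move=> [f Hf ->] [g Hg ->]; exists (a *: f + g).
  by apply: dhomogD => //; apply: dhomogZ.
by apply/rowP => i; rewrite !mxE /evalpt mevalD mevalZ.
Qed.

End WeightedProjectiveLine.

Definition hamming_weight (K : fieldType) m (c : 'rV[K]_m) : nat :=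
  #|[set i | c ord0 i != 0]|.

Definition is_min_distance (K : fieldType) m (C : 'rV[K]_m -> Prop)
    (delta : nat) : Prop :=
  (exists c, [/\ C c, c != 0 & hamming_weight c = delta]) /\
  (forall c, C c -> c != 0 -> (delta <= hamming_weight c)%N).

(* The submonoid <w1, w2> of nat; bounding the coefficients by n loses nothing
   (see numsgP), even for zero weights. *)
Definition numsg (w1 w2 n : nat) : bool :=
  [exists a : 'I_n.+1, exists b : 'I_n.+1, n == a * w1 + b * w2]%N.

Lemma numsgP w1 w2 n :
  reflect (exists a b : nat, n = a * w1 + b * w2)%N (numsg w1 w2 n).
Proof.
apply: (iffP existsP) => [[a /existsP[b /eqP nE]]|[a [b nE]]].
  by exists a, b.
have bnd c w : (c * w <= n)%N ->
    exists c' : 'I_n.+1, (c' * w = c * w)%N.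
  case: w => [_|w le]; first by exists ord0; rewrite !muln0.
  have lt : (c < n.+1)%N by rewrite ltnS (leq_trans _ le) // leq_pmulr.
  by exists (Ordinal lt).
have [|a' a'E] := bnd a w1; first by rewrite nE leq_addr.
have [|b' b'E] := bnd b w2; first by rewrite nE leq_addl.
by exists a'; apply/existsP; exists b'; rewrite a'E b'E -nE.
Qed.

Definition chi (w1 w2 n : nat) : nat := numsg w1 w2 n.

(* Main.v *)
Require Import Defs.
From mathcomp Require Import all_boot all_order all_algebra all_fingroup.
From mathcomp Require Import finalg mpoly.
From mathcomp Require Import zify.

(* Put u(x) = x1^w2 / x2^w1.  Since w1 and w2 are coprime, u is a bijection from
   the torus onto K^*.  Write d = r w1 w2 + a w1 + b w2 with a < w2 and b < w1;
   then r, a, b are unique and the monomials of degree d are the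
   t1^(a + i w2) t2^(b + (r - i) w1) for i <= r, so on the torus a form of degree
   d is a unit times g(u), with g an arbitrary univariate polynomial of degree at
   most r.  The bound on d gives r < q - 1, so the minimum distance is q - 1 - r.
   Finally k = r when a w1 + b w2 < w1 w2, in which case l is in Q, and k = r + 1
   otherwise, in which case uniqueness of (r, a, b) keeps l out of Q. *)

Set Implicit Arguments.
Unset Strict Implicit.
Unset Printing Implicit Defensive.

Import GRing.Theory.
Local Open Scope ring_scope.

(** * Arithmetic of the monoid generated by two coprime weights *)

(** Modulo [w2] the equation reads [a * w1 = m * w1], and [w1] is invertible there. *)
Lemma sylvester_digit w1 w2 r a b m n : coprime w1 w2 -> (a < w2)%N ->
  (r * (w1 * w2) + a * w1 + b * w2 = m * w1 + n * w2)%N -> (m %% w2 = a)%N.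
Proof.
move=> cop lt_a E.
have : (m * w1 == a * w1 %[mod w2])%N.
  have E' : (n * w2 + m * w1 = (r * w1 + b) * w2 + a * w1)%N by nia.
  by rewrite -(modnMDl n (m * w1)) E' modnMDl.
suff cancel_w1 : (m * w1 == a * w1 %[mod w2] -> m = a %[mod w2])%N.
  by move=> /cancel_w1; rewrite (modn_small lt_a).
(* The claim is symmetric in [m] and [a]; ordering them makes [m - a] a true difference, divisible
   by [w2] by Gauss. *)
wlog le : m a {lt_a E} / (a <= m)%N => [th|].
  case: (leqP a m) => [/th//|/ltnW le].
  by rewrite eq_sym => /(th _ _ le).
rewrite eqn_mod_dvd ?leq_mul2r ?le ?orbT // -mulnBl Gauss_dvdl 1?coprime_sym //.
by rewrite -eqn_mod_dvd // => /eqP.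
Qed.

Lemma sylvester_uniq w1 w2 r a b m n :
  (0 < w1)%N -> (0 < w2)%N -> coprime w1 w2 -> (a < w2)%N -> (b < w1)%N ->
  (r * (w1 * w2) + a * w1 + b * w2 = m * w1 + n * w2)%N ->
  [/\ m %% w2 = a, n %% w1 = b & m %/ w2 + n %/ w1 = r]%N.
Proof.
move=> w1_gt0 w2_gt0 cop lt_a lt_b E.
have Ea := sylvester_digit cop lt_a E.
have Eb : (n %% w1 = b)%N.
  apply: (@sylvester_digit w2 w1 r b a n m) => //; first by rewrite coprime_sym.
  by rewrite addnAC (mulnC w2) E addnC.
split=> //; apply/eqP; rewrite -(@eqn_pmul2r (w1 * w2)) ?muln_gt0 ?w1_gt0 //.
move: E; rewrite {1}(divn_eq m w2) {1}(divn_eq n w1) Ea Eb.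
move: (m %/ w2)%N (n %/ w1)%N => i j; nia.
Qed.

Lemma numsg_normal_form w1 w2 d : (0 < w1)%N -> (0 < w2)%N -> numsg w1 w2 d ->
  exists r a b, [/\ a < w2, b < w1 & d = r * (w1 * w2) + a * w1 + b * w2]%N.
Proof.
move=> w1_gt0 w2_gt0 /numsgP[m [n ->]].
exists (m %/ w2 + n %/ w1)%N, (m %% w2)%N, (n %% w1)%N.
split; rewrite ?ltn_pmod // {1}(divn_eq m w2) {1}(divn_eq n w1).
move: (m %/ w2)%N (n %/ w1)%N (m %% w2)%N (n %% w1)%N => i j a b; nia.
Qed.

Lemma normal_form_quotient w1 w2 r a b k l :
  (0 < w1)%N -> (0 < w2)%N -> coprime w1 w2 -> (a < w2)%N -> (b < w1)%N ->
  (l < w1 * w2)%N ->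
  (k * (w1 * w2) + l = r * (w1 * w2) + a * w1 + b * w2)%N ->
  (k + chi w1 w2 l = r + 1)%N.
Proof.
move=> w1_gt0 w2_gt0 cop lt_a lt_b lt_l E; rewrite /chi.
have W_gt0 : (0 < w1 * w2)%N by rewrite muln_gt0 w1_gt0.
have lt_e : (a * w1 + b * w2 < 2 * (w1 * w2))%N by nia.
case: (ltnP (a * w1 + b * w2) (w1 * w2)) => he.
  have lE : l = (a * w1 + b * w2)%N.
    by rewrite -(modn_small lt_l) -(modnMDl k l) E -addnA modnMDl modn_small.
  have -> : numsg w1 w2 l by apply/numsgP; exists a, b.
  nia.
case: numsgP => [[m [n lE]]|_] /=; last nia.
(* Here [k = r + 1]. A representation of [l] would give a second one of the whole sum, and
   uniqueness would make [r] equal to [k + m %/ w2 + n %/ w1], which is at least [k]. *)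
have E' : (r * (w1 * w2) + a * w1 + b * w2 = (k * w2 + m) * w1 + n * w2)%N by nia.
have [] := sylvester_uniq w1_gt0 w2_gt0 cop lt_a lt_b E'.
rewrite modnMDl divnMDl //.
have := divn_eq m w2; have := divn_eq n w1.
move: (m %/ w2)%N (n %/ w1)%N (m %% w2)%N (n %% w1)%N => i j a' b'.
nia.
Qed.

(** * The ratio as a coordinate on the torus *)

Section TorusRatio.
Variables (K : finFieldType) (w1 w2 : nat).
Hypotheses (w1_gt0 : (0 < w1)%N) (cop : coprime w1 w2).

Definition torus_ratio (x : K * K) : K := x.1 ^+ w2 / x.2 ^+ w1.

Lemma torus_ratio_scale (x : K * K) (lam : {unit K}) :
  torus_ratio (wscale w1 w2 x lam) = torus_ratio x.
Proof.
have nz : val lam != 0 by rewrite -unitfE (valP lam).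
rewrite /torus_ratio /= !exprMn -!exprM mulnC invfM.
by rewrite mulrACA mulfV ?mul1r ?expf_neq0.
Qed.

Lemma wpoint_ratio (x y : K * K) :
  wpoint w1 w2 x = wpoint w1 w2 y -> torus_ratio x = torus_ratio y.
Proof.
by move=> /orbit_eqP /orbitP[lam _ <-]; apply: torus_ratio_scale.
Qed.

Lemma torus_ratio_neq0 (x : K * K) : x.1 * x.2 != 0 -> torus_ratio x != 0.
Proof.
rewrite mulf_eq0 negb_or => /andP[x1 x2].
by rewrite mulf_neq0 ?invr_neq0 ?expf_neq0.
Qed.

(** Bezout with natural exponents, used to build both the scalar relating two points and the
    preimage of a ratio. *)
Lemma bezout_weights : exists p s, (p * w1 = s * w2 + 1)%N.
Proof.
case: (egcdnP w2 w1_gt0) => p s E _; exists p, s.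
by rewrite E (eqP (cop : gcdn _ _ == 1)%N).
Qed.

(** Equal ratios mean [z1 ^+ w2 = z2 ^+ w1] for the coordinatewise quotients [z1], [z2]. By Bezout
    the scalar [z1 ^+ p / z2 ^+ s] then has [w1]-th power [z1] and [w2]-th power [z2]. *)
Lemma torus_ratio_wpoint (x y : K * K) :
  x.1 * x.2 != 0 -> y.1 * y.2 != 0 -> torus_ratio x = torus_ratio y ->
  wpoint w1 w2 x = wpoint w1 w2 y.
Proof.
rewrite !mulf_eq0 !negb_or => /andP[x1 x2] /andP[y1 y2] eq_ratio.
have [p [s ps]] := bezout_weights.
pose z1 := x.1 / y.1; pose z2 := x.2 / y.2.
have z1_neq0 : z1 != 0 by rewrite mulf_neq0 ?invr_neq0.
have z2_neq0 : z2 != 0 by rewrite mulf_neq0 ?invr_neq0.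
have z12 : z1 ^+ w2 = z2 ^+ w1.
  rewrite /z1 /z2 !expr_div_n; apply/eqP.
  rewrite eqr_div ?expf_neq0 // [eqbRHS]mulrC.
  by rewrite -eqr_div ?expf_neq0 //; apply/eqP.
have lam_unit : z1 ^+ p / z2 ^+ s \is a GRing.unit.
  by rewrite unitfE mulf_neq0 ?invr_neq0 ?expf_neq0.
have lam1 : (z1 ^+ p / z2 ^+ s) ^+ w1 = z1.
  rewrite expr_div_n -!exprM ps addn1 exprS (mulnC s w2) (mulnC s w1) !exprM z12.
  by rewrite mulfK ?expf_neq0.
have lam2 : (z1 ^+ p / z2 ^+ s) ^+ w2 = z2.
  rewrite expr_div_n -!exprM (mulnC p) exprM z12 -exprM (mulnC w1) ps addn1 exprS.
  by rewrite mulfK ?expf_neq0.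
apply/orbit_eqP/orbitP; exists (FinRing.unit K lam_unit) => //.
rewrite -[LHS]/((z1 ^+ p / z2 ^+ s) ^+ w1 * y.1, (z1 ^+ p / z2 ^+ s) ^+ w2 * y.2).
by rewrite lam1 lam2 !divfK // -surjective_pairing.
Qed.

Lemma torus_ratio_surj (c : K) : c != 0 ->
  exists2 y : K * K, y.1 * y.2 != 0 & torus_ratio y = c.
Proof.
move=> c_neq0; have [p [s ps]] := bezout_weights.
(* The ratio of this point is [c] to the power [p * w1 - s * w2 = 1]. *)
exists ((c ^+ s)^-1, (c ^+ p)^-1).
  by rewrite mulf_neq0 ?invr_neq0 ?expf_neq0.
rewrite /torus_ratio /= !exprVn invrK -!exprM ps addn1 exprSr mulrA.
by rewrite mulVf ?mul1r ?expf_neq0.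
Qed.

Variable x : 'I_#|wptorus K w1 w2| -> K * K.
Hypothesis hx : torus_coords x.

Lemma torus_coords_neq0 i : (x i).1 * (x i).2 != 0.
Proof. by rewrite -(wpoint_torus w1 w2) -hx.2; apply: imset_f. Qed.

Lemma torus_ratio_inj : injective (torus_ratio \o x).
Proof.
move=> i j /torus_ratio_wpoint E; apply: hx.1.
by apply: E; apply: torus_coords_neq0.
Qed.

(** With [torus_ratio_inj], this lets positions of a codeword be counted as nonzero field
    elements. *)
Lemma torus_ratio_image : [set torus_ratio (x i) | i in setT] = [set~ 0].
Proof.
apply/setP => c; rewrite !inE; apply/imsetP/idP => [[i _ ->]|c_neq0].
  exact/torus_ratio_neq0/torus_coords_neq0.
have [y ynz <-] := torus_ratio_surj c_neq0.
have : wpoint w1 w2 y \in [set wpoint w1 w2 (x i) | i in 'I_#|wptorus K w1 w2|].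
  by rewrite hx.2 wpoint_torus.
case/imsetP => i _ E.
by exists i => //; apply: wpoint_ratio.
Qed.

End TorusRatio.

(** * Forms on the torus as univariate polynomials, and their roots *)

Section MinDistance.
Variables (K : finFieldType) (w1 w2 : nat).
Hypotheses (w1_gt0 : (0 < w1)%N) (w2_gt0 : (0 < w2)%N) (cop : coprime w1 w2).
Variables (r a b d : nat).
Hypotheses (lt_a : (a < w2)%N) (lt_b : (b < w1)%N).
Hypothesis dE : d = (r * (w1 * w2) + a * w1 + b * w2)%N.

Lemma evalptE (f : {mpoly K[2]}) (y : K * K) :
  evalpt f y = \sum_(m <- msupp f) f@_m * (y.1 ^+ m ord0 * y.2 ^+ m ord_max).
Proof.
rewrite /evalpt mevalE; apply: eq_bigr => m _.
by rewrite big_ord_recl big_ord1 (_ : lift _ _ = ord_max) //; apply: val_inj.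
Qed.

(** Each factor of the ratio trades [w1] powers of the second coordinate for [w2] of the first; the
    common factor is the monomial with [i = 0]. *)
Lemma torus_monomial i (y : K * K) : (i <= r)%N -> y.1 * y.2 != 0 ->
  y.1 ^+ (a + i * w2) * y.2 ^+ (b + (r - i) * w1) =
  y.1 ^+ a * y.2 ^+ (b + r * w1) * torus_ratio w1 w2 y ^+ i.
Proof.
rewrite mulf_eq0 negb_or => le_ir /andP[y1 y2].
rewrite /torus_ratio expr_div_n -!exprM exprD -!mulrA; congr (_ * _).
rewrite mulrCA (mulnC i); congr (_ * _).
have -> : (b + r * w1 = b + (r - i) * w1 + w1 * i)%N.
  by rewrite -addnA (mulnC w1) -mulnDl subnK.
by rewrite [in RHS]exprD mulfK ?expf_neq0.
Qed.

Lemma homog_evalpt (f : {mpoly K[2]}) : f \is d.-homog for (wdeg w1 w2) ->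
  exists2 g : {poly K}, (size g <= r.+1)%N &
    forall y, y.1 * y.2 != 0 ->
      evalpt f y = y.1 ^+ a * y.2 ^+ (b + r * w1) * g.[torus_ratio w1 w2 y].
Proof.
move=> /dhomogP hom.
have digits m : m \in msupp f ->
    [/\ m ord0 %% w2 = a, m ord_max %% w1 = b &
        m ord0 %/ w2 + m ord_max %/ w1 = r]%N.
  move=> /hom; rewrite /= /wdeg dE => E.
  by apply: (@sylvester_uniq w1 w2 r) => //; rewrite -E mulnC (mulnC w2).
(* The degree fixes both remainders and the sum of the quotients, so the quotient of the first
   exponent determines the monomial and is at most [r]. *)
exists (\sum_(m <- msupp f) f@_m *: 'X^(m ord0 %/ w2)).
  apply: (leq_trans (size_sum _ _ _)); apply/bigmax_leqP_seq => m /digits[_ _ Er] _.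
  by rewrite (leq_trans (size_scale_leq _ _)) // size_polyXn ltnS -Er leq_addr.
move=> y ynz; rewrite evalptE horner_sum mulr_sumr.
rewrite big_seq [RHS]big_seq; apply: eq_bigr => m /digits[Ea Eb Er].
rewrite hornerZ hornerXn [RHS]mulrCA -torus_monomial -?Er ?leq_addr //.
by rewrite addKn -{1}Ea -Eb addnC -divn_eq addnC -divn_eq.
Qed.

(** The converse of [homog_evalpt], needed to realize a word of minimum weight. *)
Lemma evalpt_homog (g : {poly K}) : (size g <= r.+1)%N ->
  exists2 f : {mpoly K[2]}, f \is d.-homog for (wdeg w1 w2) &
    forall y, y.1 * y.2 != 0 ->
      evalpt f y = y.1 ^+ a * y.2 ^+ (b + r * w1) * g.[torus_ratio w1 w2 y].
Proof.
move=> size_g.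
pose mon (i : nat) : 'X_{1..2} :=
  [multinom if j == ord0 then a + i * w2 else b + (r - i) * w1 | j < 2]%N.
exists (\sum_(i < r.+1) g`_i *: 'X_[mon i]).
  apply: rpred_sum => i _; apply: dhomogZ; rewrite dhomogX /= /wdeg !mnmE /= dE.
  have := ltn_ord i; rewrite ltnS => /subnKC; move: (nat_of_ord i) (r - i)%N => j e.
  by move=> <-; apply/eqP; nia.
move=> y ynz; rewrite /evalpt raddf_sum /= (horner_coef_wide _ size_g) mulr_sumr.
apply: eq_bigr => i _; rewrite mevalZ mevalX big_ord_recl big_ord1 !mnmE /=.
by rewrite [RHS]mulrCA -torus_monomial // -ltnS ltn_ord.
Qed.

Variable x : 'I_#|wptorus K w1 w2| -> K * K.
Hypothesis hx : torus_coords x.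

Lemma hamming_weight_torus (c : 'rV[K]_#|wptorus K w1 w2|) (g : {poly K}) :
  (forall i, c ord0 i = (x i).1 ^+ a * (x i).2 ^+ (b + r * w1) *
                        g.[torus_ratio w1 w2 (x i)]) ->
  hamming_weight c = #|[set u in [set~ 0] | ~~ root g u]|.
Proof.
move=> cE; rewrite -(torus_ratio_image w1_gt0 cop hx) /hamming_weight.
rewrite -(card_imset _ (torus_ratio_inj w1_gt0 cop hx)).
apply: eq_card => u; rewrite [RHS]inE.
have nzE i : (c ord0 i != 0) = ~~ root g (torus_ratio w1 w2 (x i)).
  have := torus_coords_neq0 hx i; rewrite mulf_eq0 negb_or => /andP[x1 x2].
  by rewrite cE !mulf_eq0 /root !negb_or !expf_neq0.
apply/imsetP/andP => [[i ci ->]|[/imsetP[i _ ->] gi]].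
  by rewrite inE /= in ci; rewrite /= -nzE ci; split=> //; apply: imset_f.
by exists i; rewrite // inE nzE.
Qed.

Hypothesis lt_r : (r < #|K|.-1)%N.

Lemma min_distance_torus : is_min_distance (wprm_code w1 w2 x d) (#|K|.-1 - r).
Proof.
have card_Kx : #|[set~ (0 : K)]| = #|K|.-1 by rewrite cardsC1.
have card_nonroots (g : {poly K}) :
    (#|[set u in [set~ 0%R] | ~~ root g u]| =
     #|K|.-1 - #|[set u in [set~ 0%R] | root g u]|)%N.
  rewrite -card_Kx -(cardsID [set u : K | root g u] [set~ 0]).
  have -> : [set~ 0] :&: [set u | root g u] = [set u in [set~ 0] | root g u].
    by apply/setP => u; rewrite !inE.
  by rewrite addKn; apply: eq_card => u; rewrite !inE andbC.
split=> [|c [f hom cE] c_neq0].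
  (* A product over [r] distinct nonzero roots attains the bound; enough of them exist by [lt_r]. *)
  pose rs := take r (enum [set~ (0 : K)]).
  have size_rs : size rs = r by rewrite size_takel // -cardE card_Kx ltnW.
  pose g : {poly K} := \prod_(u <- rs) ('X - u%:P).
  have [|f hom fE] := @evalpt_homog g; first by rewrite size_prod_XsubC size_rs.
  have weight : hamming_weight (ev x f) = (#|K|.-1 - r)%N.
    rewrite (@hamming_weight_torus _ g) => [|i]; last first.
      by rewrite mxE fE // torus_coords_neq0.
    rewrite card_nonroots; congr (_ - _)%N; rewrite -[RHS]size_rs.
    have /card_uniqP <- : uniq rs by rewrite take_uniq // enum_uniq.
    apply: eq_card => u; rewrite !inE root_prod_XsubC andb_idl //.
    by move=> /mem_take; rewrite mem_enum !inE.
  exists (ev x f); split=> //; first by exists f.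
  (* A zero word would have weight zero, contradicting [r < #|K|.-1]. *)
  apply: contraTneq lt_r => c0; rewrite -leqNgt -subn_eq0 -weight c0.
  by rewrite cards_eq0; apply/eqP/setP => i; rewrite !inE mxE eqxx.
have [g size_g gE] := homog_evalpt hom.
have c_gE i : c ord0 i = (x i).1 ^+ a * (x i).2 ^+ (b + r * w1) *
                        g.[torus_ratio w1 w2 (x i)].
  by rewrite cE mxE gE // torus_coords_neq0.
have g_neq0 : g != 0.
  apply: contra_neq c_neq0 => g0; apply/rowP => i.
  by rewrite c_gE g0 horner0 mulr0 mxE.
rewrite (hamming_weight_torus c_gE) card_nonroots leq_sub2l //.
(* A nonzero [g] has fewer roots than its size, hence at most [r]. *)
rewrite cardE -ltnS (leq_trans _ size_g) // max_poly_roots ?enum_uniq //.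
by apply/allP => u; rewrite mem_enum !inE => /andP[].
Qed.

End MinDistance.

Theorem theorem4p4 (K : finFieldType) (q : nat) (hq : #|K| = q)
  (w1 w2 : nat) (hw1 : (0 < w1)%N) (hw2 : (0 < w2)%N) (hw : coprime w1 w2)
  (x : 'I_#|wptorus K w1 w2| -> K * K) (hx : torus_coords x)
  (d : nat) (hd : (d%:Z <= (w1 * w2)%:Z * (q%:Z - 1) - w1%:Z - w2%:Z)%R)
  (hdQ : numsg w1 w2 d)
  (k l : nat) (hkl : d = (k * (w1 * w2) + l)%N) (hl : (l < w1 * w2)%N) :
  exists2 delta : nat,
    is_min_distance (wprm_code w1 w2 x d) delta &
    (delta%:Z = (q%:Z - 1) - k%:Z + 1 - (chi w1 w2 l)%:Z)%R.
Proof.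
have [r [a [b [lt_a lt_b dE]]]] := numsg_normal_form hw1 hw2 hdQ.
have q_gt0 : (0 < q)%N by rewrite -hq; apply/card_gt0P; exists 0.
have lt_r : (r < q.-1)%N.
  have W_gt0 : (0 < w1 * w2)%N by rewrite muln_gt0 hw1.
  move: dE hd; move: (w1 * w2)%N W_gt0 => W W_gt0 dE hd.
  (* If [r] were at least [q - 1], then [d] would be at least [W * (q - 1)], above the bound [hd]
     since the weights are positive. *)
  rewrite ltnNge; apply/negP => le_r.
  have : (q.-1 * W <= r * W)%N by rewrite leq_mul2r le_r orbT.
  nia.
exists (q.-1 - r)%N.
  by rewrite -hq; apply: (min_distance_torus hw1 hw2 hw lt_a lt_b dE hx); rewrite hq.
have := normal_form_quotient hw1 hw2 hw lt_a lt_b hl (etrans (esym hkl) dE).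
(* By [lt_r] the truncated subtraction in [q.-1 - r] is exact, so the identity carries over to the
   integers. *)
move: (chi _ _ _) => e; lia.
Qed.
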